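(* Let $F$ be a field of characteristic different from $2$. In the class of Lie-solvable Novikov algebras over $F$, left quasiregular algebras coincide with $\mathcal{A}$-radical algebras; that is, a Lie-solvable Novikov algebra $A$ over $F$ is left quasiregular if and only if $A=\mathcal{A}(A)$, where $\mathcal{A}(A)$ is the Andrunakievich radical of $A$.
   Context: A Novikov algebra over a field $F$ is a (not necessarily associative or unital) $F$-algebra satisfying the identities $(x,y,z)=(y,x,z)$ and $(xy)z=(xz)y$, where $(x,y,z)=(xy)z-x(yz)$. Ideals are two-sided. For an ideal $I$ of a Novikov algebra, $[I,I]$ denotes the linear span of all commutators $[a,b]=ab-ba$, $a,b\in I$; it is again an ideal of the algebra. Put $A^{(0)_L}=A$, $A^{(n+1)_L}=[A^{(n)_L},A^{(n)_L}]$. $A$ is Lie-solvable if $A^{(n)_L}=0$ for some $n\ge 0$. An element $x\in A$ is left quasiregular if there is $y\in A$ with $x+y=yx$; an algebra is left quasiregular if all its elements are left quasiregular. A nonzero algebra is subdirectly irreducible if the intersection of all its nonzero ideals is nonzero; this intersection $H$ is called its heart, and the heart is idempotent if $H^2=H$ ($H^2$ is the span of products of elements of $H$). Let $\mathcal{C}$ be the class of all subdirectly irreducible Novikov algebras with idempotent heart, and let $\mathcal{A}$ be the class of all Novikov algebras having no homomorphic image in $\mathcal{C}$. $\mathcal{A}$ is a radical class; the Andrunakievich radical $\mathcal{A}(A)$ is the largest ideal of $A$ that (as an algebra) belongs to $\mathcal{A}$. $A$ is $\mathcal{A}$-radical if $A=\mathcal{A}(A)$, i.e. $A\in\mathcal{A}$.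 *)

(* Defs.v *)
From HB Require Import structures.
From mathcomp Require Import all_boot all_order all_algebra.
From mathcomp Require Import boolp classical_sets.

Set Implicit Arguments.
Unset Strict Implicit.
Unset Printing Implicit Defensive.

Import GRing.Theory.
Local Open Scope ring_scope.
Local Open Scope classical_set_scope.

Declare Scope novikov_scope.
Delimit Scope novikov_scope with nov.
Local Open Scope novikov_scope.

(* Not necessarily associative, commutative or unital algebras of arbitrary
   dimension. *)
HB.mixin Record Lmodule_isNonAssocAlgebra (F : fieldType) A
    of GRing.Lmodule F A := {
  amul : A -> A -> A;
  amulDl : forall x y z, amul (x + y) z = amul x z + amul y z;
  amulDr : forall x y z, amul x (y + z) = amul x y + amul x z;
  amulZl : forall (a : F) x y, amul (a *: x) y = a *: amul x y;
  amulZr : forall (a : F) x y, amul x (a *: y) = a *: amul x y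
}.

#[short(type="nonAssocAlgType")]
HB.structure Definition NonAssocAlgebra (F : fieldType) :=
  {A of Lmodule_isNonAssocAlgebra F A & GRing.Lmodule F A}.

Notation "x ** y" := (amul x y) (at level 40, left associativity)
  : novikov_scope.

Definition associator (F : fieldType) (A : nonAssocAlgType F) (x y z : A) : A :=
  (x ** y) ** z - x ** (y ** z).

HB.mixin Record NonAssocAlgebra_isNovikov (F : fieldType) A
    of NonAssocAlgebra F A := {
  associatorC : forall x y z : A, associator x y z = associator y x z;
  amulAC : forall x y z : A, (x ** y) ** z = (x ** z) ** y
}.

#[short(type="novikovType")]
HB.structure Definition Novikov (F : fieldType) :=
  {A of NonAssocAlgebra_isNovikov F A & NonAssocAlgebra F A}.

Section NonAssocAlgebraTheory.
Variables (F : fieldType) (A : nonAssocAlgType F).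
Implicit Types (x y : A) (S I : set A).

Definition is_subspace S : Prop :=
  S 0 /\ forall (a : F) x y, S x -> S y -> S (a *: x + y).

Definition lin_span S : set A := smallest is_subspace S.

Definition is_ideal I : Prop :=
  is_subspace I /\ forall x y, I y -> I (x ** y) /\ I (y ** x).

Definition commutator x y : A := x ** y - y ** x.

Definition lie_derived I : set A :=
  lin_span [set z | exists x y, [/\ I x, I y & z = commutator x y]].

Definition lie_derived_series n : set A := iter n lie_derived [set: A].

Definition lie_solvable : Prop := exists n, lie_derived_series n = [set 0].

Definition left_quasiregular : Prop :=
  forall x, exists y, x + y = y ** x.

Definition set_square I : set A :=
  lin_span [set z | exists x y, [/\ I x, I y & z = x ** y]].

Definition heart : set A :=
  \bigcap_(I in [set I | is_ideal I /\ I <> [set 0]]) I.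

Definition subdirectly_irreducible : Prop :=
  [set: A] <> [set 0] /\ heart <> [set 0].

Definition idempotent_heart : Prop := set_square heart = heart.

End NonAssocAlgebraTheory.

Arguments lie_solvable {F} A.
Arguments left_quasiregular {F} A.
Arguments heart {F} A.
Arguments subdirectly_irreducible {F} A.
Arguments idempotent_heart {F} A.

Definition homomorphic_image (F : fieldType) (A B : nonAssocAlgType F) : Prop :=
  exists f : {linear A -> B},
    (forall x y, f (x ** y) = f x ** f y) /\ range f = [set: B].

Definition class_C (F : fieldType) (A : novikovType F) : Prop :=
  subdirectly_irreducible A /\ idempotent_heart A.

Definition class_A (F : fieldType) (A : novikovType F) : Prop :=
  ~ exists B : novikovType F, homomorphic_image A B /\ class_C B.

Section IdealAlgebra.
Variables (F : fieldType) (A : novikovType F) (I : set A).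

(* The proof of [is_ideal I] is an otherwise unused argument, so that it can be
   recovered from the type by canonical structure inference. *)
Definition ideal_pred (idI : is_ideal I) : {pred A} :=
  fun x => x \in I.

Definition ideal_alg (idI : is_ideal I) : Type := {x : A | ideal_pred idI x}.

Variable idI : is_ideal I.

Fact ideal_pred_submod_closed : submod_closed (ideal_pred idI).
Proof.
have [[I0 IP] _] := idI; split; first exact: mem_set.
by move=> a u v /set_mem Iu /set_mem Iv; apply: mem_set; apply: IP.
Qed.

HB.instance Definition _ :=
  GRing.isSubmodClosed.Build F A (ideal_pred idI) ideal_pred_submod_closed.

HB.instance Definition _ := SubChoice.copy (ideal_alg idI)
  {x : A | ideal_pred idI x}.

HB.instance Definition _ := [SubChoice_isSubLmodule of ideal_alg idI by <:].

Fact ideal_alg_mul_subproof (x y : ideal_alg idI) :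
  ideal_pred idI (val x ** val y).
Proof.
by apply: mem_set; case: (idI.2 (val x) (val y) (set_mem (valP y))).
Qed.

Definition ideal_alg_mul (x y : ideal_alg idI) : ideal_alg idI :=
  Sub (val x ** val y) (ideal_alg_mul_subproof x y).

Fact val_ideal_alg_mul (x y : ideal_alg idI) :
  val (ideal_alg_mul x y) = val x ** val y.
Proof. exact: SubK. Qed.

Fact ideal_alg_mulDl x y z :
  ideal_alg_mul (x + y) z = ideal_alg_mul x z + ideal_alg_mul y z.
Proof. by apply: val_inj; rewrite raddfD !val_ideal_alg_mul raddfD amulDl. Qed.

Fact ideal_alg_mulDr x y z :
  ideal_alg_mul x (y + z) = ideal_alg_mul x y + ideal_alg_mul x z.
Proof. by apply: val_inj; rewrite raddfD !val_ideal_alg_mul raddfD amulDr. Qed.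

Fact ideal_alg_mulZl (a : F) x y :
  ideal_alg_mul (a *: x) y = a *: ideal_alg_mul x y.
Proof. by apply: val_inj; rewrite linearZ !val_ideal_alg_mul linearZ amulZl. Qed.

Fact ideal_alg_mulZr (a : F) x y :
  ideal_alg_mul x (a *: y) = a *: ideal_alg_mul x y.
Proof. by apply: val_inj; rewrite linearZ !val_ideal_alg_mul linearZ amulZr. Qed.

HB.instance Definition _ :=
  Lmodule_isNonAssocAlgebra.Build F (ideal_alg idI)
    ideal_alg_mulDl ideal_alg_mulDr ideal_alg_mulZl ideal_alg_mulZr.

Fact ideal_alg_associatorC (x y z : ideal_alg idI) :
  associator x y z = associator y x z.
Proof.
by apply: val_inj; rewrite !raddfB; apply: (associatorC (val x)).
Qed.

Fact ideal_alg_mulAC (x y z : ideal_alg idI) : (x ** y) ** z = (x ** z) ** y.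
Proof. by apply: val_inj; apply: (amulAC (val x)). Qed.

HB.instance Definition _ := NonAssocAlgebra_isNovikov.Build F (ideal_alg idI)
  ideal_alg_associatorC ideal_alg_mulAC.

End IdealAlgebra.

Section AndrunakievichRadical.
Variables (F : fieldType) (A : novikovType F).

Definition class_A_ideal (I : set A) : Prop :=
  exists idI : is_ideal I, class_A (ideal_alg idI).

Definition largest_class_A_ideal (I : set A) : Prop :=
  class_A_ideal I /\ forall J : set A, class_A_ideal J -> J `<=` I.

(* The default value [set0] of [xget] is never an ideal, hence never equal to
   [set: A]. *)
Definition andrunakievich_radical : set A := xget set0 largest_class_A_ideal.

End AndrunakievichRadical.

Arguments andrunakievich_radical {F} A.

(* Main.v *)
Require Import Defs.
From HB Require Import structures.
From mathcomp Require Import all_boot all_order all_algebra.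
From mathcomp Require Import boolp classical_sets functions.
From mathcomp Require Import ring.

(* Write L_u and R_z for left and right multiplication.

   If B is Lie-solvable with idempotent heart H, the last nonzero term of the
   Lie derived series contains H, so H is commutative. The Novikov identities
   then give H[B,B] = 0, which forces [B,B] = 0 (otherwise H is contained in
   [B,B] and H^2 = 0). Thus B is commutative and associative and H contains a
   local unit e with he = h <> 0, for which e + y = ye has no solution.

   Conversely, suppose x + y = yx has no solution y. The operators R_z commute
   and generate with the scalars a commutative ring S, on which [L_u, -] is a
   derivation. The s in S with sx in A(R_x - 1) form a proper ideal; let K be a
   residue field of S at a maximal ideal above it, and let r(z) be the class of
   R_z in K, so that r(x) = 1. Let J be the last term of the Lie derived series
   on which r does not vanish. For y, z in J the square of
   a = R_(yz) - R_y R_z is expressed by R_c with c in [J,J], so a vanishes in K;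
   applying [L_u, -] twice to a^2, [L_u, a] vanishes in K as well, since the
   characteristic is not 2. These relations on J suffice to show that r is
   multiplicative on all of A, and the field K is then a homomorphic image of A
   in the class C. *)

Set Implicit Arguments.
Unset Strict Implicit.
Unset Printing Implicit Defensive.

Import GRing.Theory.
Local Open Scope ring_scope.
Local Open Scope classical_set_scope.
Local Open Scope novikov_scope.

(** * Maximal ideals and residue fields of commutative rings *)

Lemma exists_maximal_ideal (S : comNzRingType) (I : set S) :
    I 0 -> (forall a u v, I u -> I v -> I (a * u + v)) -> ~ I 1 ->
  exists M : idealr S, (forall s, I s -> s \in M) /\
    forall s, s \notin M -> exists t, 1 - t * s \in M.
Proof.
move=> I0 Iadd I1.
(* The conditions bear on the union with [I] so that the empty chain, whose union is empty, also
   satisfies [P]. *)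
pose P : set (set S) := [set J |
  (forall a u v, (I `|` J) u -> (I `|` J) v -> (I `|` J) (a * u + v)) /\
  ~ (I `|` J) 1].
have [K [[Kadd K1] Kmax]] : exists K, P K /\ forall L, K `<` L -> ~ P L.
  apply: Zorn_bigcup => G GP Gtot; split.
    have up X u : G X -> (I `|` X) u -> (I `|` \bigcup_(X in G) X) u.
      by move=> GX [Iu|Xu]; [left|right; exists X].
    move=> a u v [Iu|[X GX Xu]] [Iv|[Y GY Yv]].
    - by left; apply: Iadd.
    - by apply: (up Y) => //; apply: (GP Y GY).1; [left|right].
    - by apply: (up X) => //; apply: (GP X GX).1; [right|left].
    - have [XY|YX] := Gtot _ _ GX GY.
        by apply: (up Y) => //; apply: (GP Y GY).1; right => //; apply: XY.
      by apply: (up X) => //; apply: (GP X GX).1; right => //; apply: YX.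
  by case=> [//|[X GX X1]]; apply: (GP X GX).2; right.
pose M : {pred S} := fun s => `[< (I `|` K) s >].
have MP : idealr_closed M.
  split; first by apply/asboolP; left.
    by apply/asboolP.
  by move=> a u v /asboolP Mu /asboolP Mv; apply/asboolP; apply: Kadd.
pose Mm := isIdealr.Build S M MP.
pose MI : idealr S := HB.pack M Mm.
exists MI; split=> [s Is|s /asboolP nMs]; first by apply/asboolP; left.
have {}Kadd a u v : (I `|` K) u -> (I `|` K) v -> (I `|` K) (a * u + v).
  exact: Kadd.
(* [L] is the ideal generated by [M] and [s]; maximality forces it to contain 1. *)
pose L : set S := [set z | exists t m, (I `|` K) m /\ z = t * s + m].
have IKL z : (I `|` K) z -> L z by exists 0, z; rewrite mul0r add0r.
have IL z : I z -> L z by move=> Iz; apply: IKL; left.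
have KL : K `<` L.
  split=> [z Kz|LK]; first by apply: IKL; right.
  apply: nMs; right; apply: LK; exists 1, 0; rewrite mul1r addr0.
  by split=> //; left.
have [//|] := pselect (exists t, 1 - t * s \in MI).
move=> no; exfalso; apply: (Kmax _ KL); split.
  have LL z : (I `|` L) z -> L z by case=> [/IL|].
  move=> a u v /LL[t [m [Mm' ->]]] /LL[t' [m' [Mm'' ->]]]; right.
  exists (a * t + t'), (a * m + m'); split; first exact: Kadd.
  by ring.
case=> [//|[t [m [Mm' e]]]]; apply: no; exists t; apply/asboolP.
by rewrite e addrAC subrr add0r.
Qed.

Lemma exists_residue_field (S : comNzRingType) (I : set S) :
    I 0 -> (forall a u v, I u -> I v -> I (a * u + v)) -> ~ I 1 ->
  exists (K : fieldType) (rho : {rmorphism S -> K}),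
    (forall k, exists s, rho s = k) /\ forall s, I s -> rho s = 0.
Proof.
move=> I0 Iadd I1; have [M [IM Mmax]] := exists_maximal_ideal I0 Iadd I1.
pose Q := {ideal_quot M}.
have piE (s : S) : (\pi_Q s == 0)%qT = (s \in M).
  by rewrite -[0](rmorph0 (\pi_Q)%qT) -Quotient.idealrBE subr0.
have invP (q : Q) : exists q', q != 0 -> q' * q = 1.
  elim/quotW: q => s; have [Ms|nMs] := boolP (s \in M).
    by exists 0; rewrite piE Ms.
  have [t] := Mmax s nMs.
  rewrite -piE rmorphB rmorphM rmorph1 subr_eq0 => /eqP e.
  by exists (\pi_Q t)%qT.
pose inv (q : Q) : Q := if q == 0 then 0 else sval (cid (invP q)).
have mulVq (q : Q) : q != 0 -> inv q * q = 1.
  by move=> q0; rewrite /inv ifN //; apply: (svalP (cid (invP q))).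
have inv0 : inv 0 = 0 by rewrite /inv ifT.
pose K : fieldType := HB.pack Q (GRing.ComNzRing_isField.Build Q mulVq inv0).
exists K, (\pi_Q)%qT; split=> [k|s Is]; last by apply/eqP; rewrite piE IM.
by elim/quotW: k => s; exists s.
Qed.

(* Embedding an abelian group into a commutative ring lets [ring] decide the
   identities between its elements. *)
Definition trivial_extension (V : zmodType) : Type := (int * V)%type.

(** * The square-zero extension of the integers by an abelian group *)

Section TrivialExtension.
Variable V : zmodType.
Local Notation E := (trivial_extension V).
Implicit Types x y z : E.

HB.instance Definition _ := GRing.Zmodule.copy E (int * V)%type.

Let one : E := (1, 0).
Let mul x y : E := (x.1 * y.1, y.2 *~ x.1 + x.2 *~ y.1).

Fact trivial_extension_mulA : associative mul.
Proof.
move=> x y z; congr pair; rewrite /= ?mulrA // !mulrzDl -!mulrzA addrA.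
by congr (_ *~ _ + _ *~ _ + _ *~ _); rewrite mulrC.
Qed.

Fact trivial_extension_mulC : commutative mul.
Proof. by move=> x y; congr pair; rewrite /= ?(mulrC y.1) // addrC. Qed.

Fact trivial_extension_mul1 : left_id one mul.
Proof. by case=> a v; rewrite /mul /= mul1r mul0rz addr0. Qed.

Fact trivial_extension_mulDl : left_distributive mul +%R.
Proof.
move=> x y z; congr pair; rewrite /= ?mulrDl // mulrzDr mulrzDl.
by rewrite addrACA.
Qed.

Fact trivial_extension_one_neq0 : one != 0.
Proof. by []. Qed.

HB.instance Definition _ := GRing.Zmodule_isComNzRing.Build E
  trivial_extension_mulA trivial_extension_mulC trivial_extension_mul1
  trivial_extension_mulDl trivial_extension_one_neq0.

Definition to_trivial_extension (v : V) : E := (0, v).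

Fact to_trivial_extension_additive : zmod_morphism to_trivial_extension.
Proof. by move=> v w; congr pair; rewrite subrr. Qed.

HB.instance Definition _ := GRing.isZmodMorphism.Build V E
  to_trivial_extension to_trivial_extension_additive.

Lemma to_trivial_extension_inj : injective to_trivial_extension.
Proof. by move=> v w [->]. Qed.

End TrivialExtension.

Local Ltac abelian := apply: to_trivial_extension_inj; ring.

(** * Novikov identities, the Lie derived series and the heart *)

Section NovikovTheory.
Variables (F : fieldType) (A : novikovType F).
Implicit Types x y z : A.

Lemma amulBl x y z : (x - y) ** z = x ** z - y ** z.
Proof. by rewrite amulDl -(scaleN1r y) amulZl scaleN1r. Qed.

Lemma amulBr x y z : x ** (y - z) = x ** y - x ** z.
Proof. by rewrite amulDr -(scaleN1r z) amulZr scaleN1r. Qed.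

Lemma amul0l x : 0 ** x = 0.
Proof. by have := amulZl 0 0 x; rewrite !scale0r. Qed.

Lemma amulr0 x : x ** 0 = 0.
Proof. by have := amulZr 0 x 0; rewrite !scale0r. Qed.

(** Left symmetry solved for a right-nested product, for use as a rewriting rule. *)
Lemma amulA x y z :
  x ** (y ** z) = (x ** y) ** z - (y ** x) ** z + y ** (x ** z).
Proof.
have := associatorC x y z; rewrite /associator => e.
transitivity ((x ** y) ** z - ((x ** y) ** z - x ** (y ** z))).
  by abelian.
by rewrite e; abelian.
Qed.

Lemma lin_span_subspace (S : set A) : is_subspace (lin_span S).
Proof.
split=> [M [[]]//|a x y Sx Sy M MP]; apply: MP.1.2.
  exact: Sx.
exact: Sy.
Qed.

Lemma subspaceB (S : set A) x y : is_subspace S -> S x -> S y -> S (x - y).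
Proof. by case=> _ SP Sx Sy; rewrite addrC -scaleN1r; apply: SP. Qed.

Lemma subspaceD (S : set A) x y : is_subspace S -> S x -> S y -> S (x + y).
Proof. by case=> _ SP Sx Sy; rewrite -(scale1r x); apply: SP. Qed.

Lemma subspaceZ (S : set A) a x : is_subspace S -> S x -> S (a *: x).
Proof. by case=> S0 SP Sx; rewrite -[_ *: _]addr0; apply: SP. Qed.

Lemma ideal_setT : is_ideal [set: A].
Proof. by []. Qed.

Lemma lie_derived_commutator (I : set A) x y :
  I x -> I y -> lie_derived I (commutator x y).
Proof. by move=> Ix Iy; apply: sub_gen_smallest; exists x, y. Qed.

Lemma lie_derivedS (I J : set A) : I `<=` J -> lie_derived I `<=` lie_derived J.
Proof.
move=> IJ; apply: smallest_sub; first exact: lin_span_subspace.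
by move=> _ [x [y [/IJ Jx /IJ Jy ->]]]; apply: lie_derived_commutator.
Qed.

(** Right products are handled by 2[a,b]x = [ax,b] + [a,bx], which is where 2 must be invertible;
    left products then follow from the Jacobi identity for x, a, b. *)
Lemma lie_derived_ideal (I : set A) :
  2%N \notin [pchar F] -> is_ideal I -> is_ideal (lie_derived I).
Proof.
move=> char2 [Isub Imul]; split; first exact: lin_span_subspace.
have Lsub : is_subspace (lie_derived I) := lin_span_subspace _.
move=> x; apply: smallest_sub.
  split=> [|k y z [Lxy Lyx] [Lxz Lzx]].
    rewrite amul0l amulr0.
    by split; apply: Lsub.1.
  rewrite amulDl amulDr amulZl amulZr.
  by split; apply: Lsub.2.
move=> _ [a [b [Ia Ib ->]]].
have [[Ixa Iax] [Ixb Ibx]] := (Imul x a Ia, Imul x b Ib).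
have Lr : lie_derived I (commutator a b ** x).
  have two_neq0 : 2%:R != 0 :> F by apply: contra char2 => e; rewrite !inE.
  have -> : commutator a b ** x =
      2%:R^-1 *: (commutator (a ** x) b + commutator a (b ** x)).
    apply: (scalerI two_neq0); rewrite scalerA divff // scale1r scaler_nat.
    rewrite /commutator amulBl (amulA b a x) (amulAC a b x) (amulAC b a x).
    by abelian.
  apply: (subspaceZ _ Lsub); apply: (subspaceD Lsub);
    exact: lie_derived_commutator.
split=> //.
have -> : x ** commutator a b = commutator a b ** x +
   (commutator (x ** a - a ** x) b + commutator a (x ** b - b ** x)).
  rewrite /commutator !(amulBl, amulBr).
  rewrite (amulA x a b) (amulA x b a) (amulA a b x) (amulAC a x b).
  rewrite (amulAC b x a); by abelian.
apply: (subspaceD Lsub) => //; apply: (subspaceD Lsub).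
  by apply: lie_derived_commutator => //; apply: subspaceB.
by apply: lie_derived_commutator => //; apply: subspaceB.
Qed.

Lemma lie_derived_series_ideal n :
  2%N \notin [pchar F] -> is_ideal (@lie_derived_series F A n).
Proof.
by move=> char2; elim: n => // n IH; apply: lie_derived_ideal.
Qed.

Lemma lie_derived0 (I : set A) :
  lie_derived I = [set 0] -> forall x y, I x -> I y -> x ** y = y ** x.
Proof.
move=> I0 x y Ix Iy; apply/eqP; rewrite -subr_eq0; apply/eqP.
suff : [set 0] (commutator x y) by [].
by rewrite -I0; apply: lie_derived_commutator.
Qed.

Lemma ideal0_neq (I : set A) : is_ideal I -> I <> [set 0] ->
  exists2 x, I x & x <> 0.
Proof.
move=> Iid I0; apply: contrapT => no; apply: I0.
apply/seteqP; split=> [x Ix|x ->].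
  by apply: contrapT => x0; apply: no; exists x.
exact: Iid.1.1.
Qed.

Lemma heart_ideal : is_ideal (heart A).
Proof.
split; first split.
- by move=> I [[[]]].
- by move=> a x y Hx Hy I II; apply: II.1.1.2; [apply: Hx|apply: Hy].
move=> x y Hy; split=> I II.
  by case: (II.1.2 x y (Hy I II)).
by case: (II.1.2 x y (Hy I II)).
Qed.

Lemma heart_sub (I : set A) : is_ideal I -> I <> [set 0] -> heart A `<=` I.
Proof. by move=> Iid I0 x; apply. Qed.

(* Expanding (xy)(hk) once as (x(hk))y and once by left symmetry in xy and h
   gives (h(xy))k = ((hx)y)k, so R_(xy) and R_y R_x agree on hk. *)
Lemma commutative_ideal_mul_commutator (H : set A) h k x y : is_ideal H ->
    (forall u v, H u -> H v -> u ** v = v ** u) ->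
  H h -> H k -> (h ** k) ** commutator x y = 0.
Proof.
move=> [_ Hmul] HC Hh Hk.
have key z t : (h ** (z ** t)) ** k = ((h ** z) ** t) ** k.
  have [Hzk _] := Hmul z k Hk; have [_ Hzkt] := Hmul t _ Hzk.
  have := amulA (z ** t) h k.
  rewrite (amulAC z t (h ** k)) (amulA z h k) !(amulBl, amulDl).
  rewrite (amulAC z t h) (amulAC z t k) (amulAC (z ** h) k t).
  rewrite (amulAC (h ** z) k t) (HC h (z ** k)) // (amulAC (z ** k) h t).
  rewrite (HC h (z ** k ** t)) // => e.
  set a := z ** h ** t ** k in e; set b := (h ** z ** t) ** k in e *.
  set c := (z ** k ** t) ** h in e; set d := (h ** (z ** t)) ** k in e *.
  transitivity (d + (a - d + c) - (a - b + c)); last by abelian.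
  by rewrite -e; abelian.
rewrite /commutator amulBr (amulAC h k (x ** y)) (amulAC h k (y ** x)) !key.
by rewrite (amulAC h y x) subrr.
Qed.

Lemma quasiregular_not_class_C : 2%N \notin [pchar F] ->
  lie_solvable A -> left_quasiregular A -> ~ class_C A.
Proof.
move=> char2 [n0 An0] lqr [[A0 H0] HH].
have Hid := heart_ideal; have [[_ Hmul]] := Hid.
(* The last nonzero term of the series; term 0 is nonzero because [A] is. *)
have {n0 An0} [n [An An1]] : exists n, @lie_derived_series F A n <> [set 0] /\
    @lie_derived_series F A n.+1 = [set 0].
  elim: n0 An0 => [//|m IH Am1].
  by have [/IH//|Am] := pselect (@lie_derived_series F A m = [set 0]); exists m.
have HC u v : heart A u -> heart A v -> u ** v = v ** u.
  have sub := heart_sub (lie_derived_series_ideal n char2) An.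
  by move=> /sub Hu /sub Hv; apply: (lie_derived0 An1).
have HK h x y : heart A h -> h ** commutator x y = 0.
  rewrite -HH; move: h; apply: smallest_sub.
    split=> [|a u v /= u0 v0]; first by rewrite amul0l.
    by rewrite amulDl amulZl u0 v0 scaler0 addr0.
  move=> _ [h [k [Hh Hk ->]]] /=.
  exact: (commutative_ideal_mul_commutator x y Hid HC Hh Hk).
have AC : lie_derived [set: A] = [set 0].
  have Kid := lie_derived_ideal char2 ideal_setT.
  apply: contrapT => K0; have sub := heart_sub Kid K0.
  have HL h k : heart A h -> lie_derived [set: A] k -> h ** k = 0.
    move=> Hh; move: k; apply: smallest_sub.
      split=> [|a u v /= u0 v0]; first by rewrite amulr0.
      by rewrite amulDr amulZr u0 v0 scaler0 addr0.
    by move=> _ [x [y [_ _ ->]]]; apply: HK.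
  apply: H0; apply/seteqP; split=> [x|x ->]; last exact: Hid.1.1.
  rewrite -HH; move: x; apply: smallest_sub.
    by split=> [//|a u v /= -> ->]; rewrite scaler0 addr0.
  by move=> _ [h [k [Hh /sub Kk ->]]]; apply: HL.
have {AC}AC x y : x ** y = y ** x by apply: (lie_derived0 AC).
have AA x y z : x ** (y ** z) = (x ** y) ** z.
  by rewrite (AC x (y ** z)) (AC y z) amulAC (AC z x) (amulAC x) .
have [h [k [Hh Hk hk0]]] : exists h k, [/\ heart A h, heart A k & h ** k <> 0].
  apply: contrapT => no; apply: H0; rewrite -HH; apply/seteqP.
  split=> [|x ->]; last exact: (lin_span_subspace _).1.
  apply: smallest_sub.
    by split=> [//|a u v /= -> ->]; rewrite scaler0 addr0.
  move=> _ [h [k [Hh Hk ->]]]; apply: contrapT => hk0; apply: no.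
  by exists h, k.
(* The principal ideal hA contains hk, hence the whole heart and h itself; this yields the local
   unit e with h = he. *)
pose I : set A := [set z | exists t, z = h ** t].
have Iid : is_ideal I.
  split=> [|x _ [t ->]]; first split.
  - by exists 0; rewrite amulr0.
  - by move=> a _ _ [s ->] [t ->]; exists (a *: s + t); rewrite amulDr amulZr.
  split; last by exists (t ** x); rewrite AA.
  by exists (t ** x); rewrite AC AA.
have I0 : I <> [set 0].
  by move=> e; apply: hk0; have : [set 0] (h ** k) by rewrite -e; exists k.
have [e he] : I h := heart_sub Iid I0 Hh.
have [y ey] := lqr e.
case: hk0; suff -> : h = 0 by rewrite amul0l.
(* Multiplying e + y = ye by h gives h + hy = hy. *)
have := congr1 (amul h) ey; rewrite (AC y e) AA -he amulDr -he => hy.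
transitivity (h + h ** y - h ** y); first by abelian.
by rewrite hy subrr.
Qed.

End NovikovTheory.

(** Lets [ring] derive an equation from a hypothesis by comparing the differences of their sides. *)
Lemma eq_of_eq_sub (V : zmodType) (a b c d : V) :
  c = d -> a - b = c - d -> a = b.
Proof. by move=> ->; rewrite subrr => /subr0_eq. Qed.

(** * Multiplicativity of the residue of right multiplications *)

Section RightMultiplicationRing.
Variables (F : fieldType) (A : novikovType F) (S : comNzRingType).
(* R z stands for right multiplication by z and delta u for the commutator with
   left multiplication by u. *)
Variables (R : {additive A -> S}) (delta : A -> {additive S -> S}).
Hypothesis deltaM :
  forall u s t, delta u (s * t) = delta u s * t + s * delta u t.
Hypothesis deltaR : forall u v, delta u (R v) = R (u ** v) - R u * R v.
Hypothesis RM : forall x y z,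
  R ((x ** y) ** z) = R z * R (x ** y) + R y * R (x ** z) - R x * R y * R z.

(** By [deltaR] this is also [delta y (R z)]. *)
Definition defect y z : S := R (y ** z) - R y * R z.

(** For y, z in an ideal [J], the right side involves [R] at elements of [lie_derived J] only. *)
Lemma defect_sqr y z :
  defect y z * defect y z = - defect (commutator (y ** z) y) z.
Proof. by rewrite /defect /commutator amulBl !raddfB /= !RM; ring. Qed.

Variables (K : fieldType) (rho : {rmorphism S -> K}).
Hypothesis two_neq0 : 2%:R != 0 :> K.
Variable J : set A.
Hypotheses (Jid : is_ideal J) (J'id : is_ideal (lie_derived J)).
Hypothesis rJ' : forall c, lie_derived J c -> rho (R c) = 0.
Local Notation r v := (rho (R v)).

Lemma defect_rho y z : J y -> J z -> rho (defect y z) = 0.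
Proof.
move=> Jy Jz; apply/eqP; rewrite -sqrf_eq0 expr2 -rmorphM defect_sqr.
have J'c : lie_derived J (commutator (y ** z) y).
  by apply: lie_derived_commutator => //; apply: (Jid.2 _ _ Jz).1.
have J'cz := (J'id.2 z _ J'c).2.
rewrite /defect rmorphN rmorphB rmorphM /= (rJ' J'c) (rJ' J'cz).
by rewrite mul0r subrr oppr0.
Qed.

(* Applying delta u twice to a^2, where a is the defect, and dropping the terms
   known to vanish leaves 2 (delta u a)^2. *)
Lemma delta_defect_rho u y z : J y -> J z -> rho (delta u (defect y z)) = 0.
Proof.
move=> Jy Jz; have d0 := defect_rho Jy Jz.
have : lie_derived J (commutator (y ** z) y).
  by apply: lie_derived_commutator => //; apply: (Jid.2 _ _ Jz).1.
have := defect_sqr y z; move: (commutator _ _) => c.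
rewrite {3}/defect opprB; move: (defect y z) d0 => a d0 sqr J'c.
have rd1 w : lie_derived J w -> rho (delta u (R w)) = 0.
  move=> J'w; rewrite deltaR rmorphB rmorphM /=.
  by rewrite (rJ' (J'id.2 u _ J'w).1) (rJ' J'w) mulr0 subrr.
have rd2 w : lie_derived J w -> rho (delta u (delta u (R w))) = 0.
  move=> J'w; have J'uw := (J'id.2 u _ J'w).1.
  rewrite deltaR raddfB deltaM !(rmorphB, rmorphD, rmorphM) /=.
  by rewrite (rd1 _ J'uw) (rd1 _ J'w) (rJ' J'w) !mulr0 addr0 subrr.
have J'cz := (J'id.2 z _ J'c).2.
have := congr1 (fun s => rho (delta u (delta u s))) sqr.
rewrite /= !(raddfB, raddfD, deltaM) /=.
rewrite !(rmorphD, rmorphM, rmorphB) /= d0 (rd2 _ J'cz) (rd2 _ J'c) (rd1 _ J'c).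
rewrite (rJ' J'c).
rewrite !(mul0r, mulr0, addr0, add0r, subr0) -mulr2n => /eqP.
by rewrite -mulr_natl mulf_eq0 (negPf two_neq0) mulf_eq0 orbb => /eqP.
Qed.

Lemma residue_mul_in y z : J y -> J z -> r (y ** z) = r y * r z.
Proof.
move=> Jy Jz; apply/eqP; rewrite -subr_eq0 -rmorphM -rmorphB.
by apply/eqP; apply: defect_rho.
Qed.

(** Expanding [delta_defect_rho] by the derivation rules brings in a left factor u outside [J]. *)
Lemma residue_left_mul_in u y z : J y -> J z ->
  r (u ** (y ** z)) = r (u ** y) * r z + r y * r (u ** z) - r u * r y * r z.
Proof.
move=> Jy Jz; have := delta_defect_rho u Jy Jz.
rewrite /defect raddfB /= deltaM !deltaR !(rmorphB, rmorphD, rmorphM) /=.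
rewrite (residue_mul_in Jy Jz) => e.
by apply: (eq_of_eq_sub e); ring.
Qed.

Variable x0 : A.
Hypotheses (Jx0 : J x0) (rx0 : r x0 != 0).

(** Computing r(u(xx)) once by [residue_left_mul_in] and once by left symmetry leaves r(x)(r(ux) -
    r(xu)) = 0. *)
Lemma residue_commute_neq0 x u : J x -> r x != 0 -> r (u ** x) = r (x ** u).
Proof.
move=> Jx rx; apply/(mulfI rx)/eqP; rewrite -subr_eq0; apply/eqP.
have [Jux Jxu] := Jid.2 u x Jx.
have := residue_left_mul_in u Jx Jx; rewrite (amulA u x x) !(raddfB, raddfD) /=.
rewrite !RM !(rmorphB, rmorphD, rmorphM) /=.
rewrite (residue_mul_in Jx Jx) (residue_mul_in Jx Jux) => e.
by apply: (eq_of_eq_sub e); ring.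
Qed.

Lemma residue_commute x u : J x -> r (u ** x) = r (x ** u).
Proof.
move=> Jx; have [rx|] := eqVneq (r x) 0; last exact: residue_commute_neq0.
(* If r(x) = 0, then x0 and x + x0 both have nonzero residue, and the relation is additive in x. *)
have Jxx0 : J (x + x0) by apply: (subspaceD Jid.1).
have : r (x + x0) != 0 by rewrite !raddfD /= rx add0r.
move/(residue_commute_neq0 u Jxx0).
by rewrite amulDl amulDr !raddfD /= (residue_commute_neq0 u Jx0 rx0) => /addIr.
Qed.

(** Since x0 z lies in [J], z commutes with it under r; with left symmetry this gives 2r((zz)x0) =
    2r((x0 z)z), and [RM] expands both sides. *)
Lemma residue_sqr z : r x0 * r (z ** z) = r z * r (z ** x0).
Proof.
have Jx0z := (Jid.2 z _ Jx0).2; have zx0 := residue_commute z Jx0.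
apply: (mulfI two_neq0).
have := residue_commute z Jx0z; rewrite (amulA z x0 z) !(raddfB, raddfD) /=.
rewrite -(residue_commute (z ** z) Jx0) (amulAC z x0 z) !RM.
rewrite !(rmorphB, rmorphD, rmorphM) /= -zx0 => e.
by apply: (eq_of_eq_sub e); ring.
Qed.

(** Polarization: put z + x0 for z in [residue_sqr] and subtract the relation for z. *)
Lemma residue_mul_x0 z : r (z ** x0) = r z * r x0.
Proof.
apply: (mulfI rx0).
have := residue_sqr (z + x0); rewrite !(amulDl, amulDr) !raddfD /=.
rewrite -(residue_commute z Jx0) (residue_mul_in Jx0 Jx0) !mulrDr.
rewrite (residue_sqr z) => e.
by apply: (eq_of_eq_sub e); ring.
Qed.

(** Apply r to left symmetry for x0, z, w. On the right, the first and last terms become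
    r(x0)r(z)r(w) and the middle one -r(x0)r(zw); the left side is r(x0)r(zw), hence the factor 2 to
    cancel. *)
Lemma residue_mul z w : r (z ** w) = r z * r w.
Proof.
apply/(mulfI two_neq0)/(mulfI rx0).
have Jx0w := (Jid.2 w _ Jx0).2.
have := amulA x0 z w; move/(congr1 R); rewrite !(raddfB, raddfD) /= !RM.
move/(congr1 rho); rewrite !(rmorphB, rmorphD, rmorphM) /=.
rewrite (residue_commute z Jx0w) RM !(rmorphB, rmorphD, rmorphM) /=.
rewrite -!(residue_commute _ Jx0) !residue_mul_x0 => e.
by apply: (eq_of_eq_sub e); ring.
Qed.

End RightMultiplicationRing.

(** * The commutative ring generated by scalars and right multiplications *)

Section MultiplicationRing.
Variables (F : fieldType) (A : novikovType F).
Implicit Types (u v w z : A) (f g : A -> A).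

Inductive is_multiplier : (A -> A) -> Prop :=
| is_multiplier_scale (a : F) : is_multiplier (fun v => a *: v)
| is_multiplier_mulr z : is_multiplier (fun v => v ** z)
| is_multiplier_sub f g :
    is_multiplier f -> is_multiplier g -> is_multiplier (f \- g)
| is_multiplier_comp f g :
    is_multiplier f -> is_multiplier g -> is_multiplier (f \o g).

Lemma is_multiplier0 : is_multiplier 0.
Proof.
have -> : 0 = (fun v => 0 *: v) :> (A -> A).
  by apply/funext=> v; rewrite scale0r.
exact: is_multiplier_scale.
Qed.

Lemma is_multiplier1 : is_multiplier id.
Proof.
have -> : id = (fun v => 1 *: v) by apply/funext=> v; rewrite scale1r.
exact: is_multiplier_scale.
Qed.

Lemma is_multiplierB f g :
  is_multiplier f -> is_multiplier g -> is_multiplier (f - g).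
Proof. exact: is_multiplier_sub. Qed.

Lemma is_multiplierD f g :
  is_multiplier f -> is_multiplier g -> is_multiplier (f + g).
Proof.
move=> mf mg; rewrite -[g]opprK; apply: is_multiplierB => //.
by rewrite -sub0r; apply: is_multiplierB => //; apply: is_multiplier0.
Qed.

Lemma multiplier_sub f u v : is_multiplier f -> f (u - v) = f u - f v.
Proof.
move=> mf; elim: mf u v => [a|z|g h _ IHg _ IHh|g h _ IHg _ IHh] u v /=.
- exact: scalerBr.
- exact: amulBl.
- by rewrite IHg IHh; abelian.
- by rewrite IHh IHg.
Qed.

Lemma multiplier_scale f a v : is_multiplier f -> f (a *: v) = a *: f v.
Proof.
move=> mf; elim: mf v => [b|z|g h _ IHg _ IHh|g h _ IHg _ IHh] v /=.
- by rewrite !scalerA mulrC.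
- exact: amulZl.
- by rewrite IHg IHh scalerBr.
- by rewrite IHh IHg.
Qed.

Lemma multiplier_amul f v z : is_multiplier f -> f (v ** z) = f v ** z.
Proof.
move=> mf; elim: mf v => [b|w|g h _ IHg _ IHh|g h _ IHg _ IHh] v /=.
- by rewrite amulZl.
- exact: amulAC.
- by rewrite IHg IHh amulBl.
- by rewrite IHh IHg.
Qed.

Lemma multiplierC f g : is_multiplier f -> is_multiplier g -> f \o g = g \o f.
Proof.
move=> mf mg; apply/funext.
elim: mg => [a|z|h k _ IHh _ IHk|h k _ IHh _ IHk] v /=.
- exact: multiplier_scale.
- exact: multiplier_amul.
- by rewrite multiplier_sub // [f _]IHh [f (k v)]IHk.
- by rewrite [LHS]IHh /=; congr (h _); apply: IHk.
Qed.

(** The commutator of left multiplication by u with f. *)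
Definition left_derivation u f : A -> A := fun v => u ** f v - f (u ** v).

(** Left symmetry in operator form, [L_u, R_z] = R_(uz) - R_u R_z; it keeps these commutators among
    the multipliers. *)
Lemma left_derivation_mulr u z :
  left_derivation u (fun v => v ** z) = (fun v => v ** (u ** z) - v ** z ** u).
Proof.
by apply/funext => v; rewrite /left_derivation amulA (amulAC v z u); abelian.
Qed.

Lemma is_multiplier_left_derivation u f :
  is_multiplier f -> is_multiplier (left_derivation u f).
Proof.
elim=> [a|z|g h mg IHg mh IHh|g h mg IHg mh IHh].
- have -> : left_derivation u (fun v => a *: v) = 0.
    by apply/funext => v; rewrite /left_derivation amulZr subrr.
  exact: is_multiplier0.
- rewrite left_derivation_mulr.
  apply: (@is_multiplierB (fun v => v ** (u ** z))).
    exact: is_multiplier_mulr.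
  by apply: (@is_multiplier_comp (fun v => v ** u) (fun v => v ** z));
    apply: is_multiplier_mulr.
- have -> : left_derivation u (g \- h) =
      left_derivation u g - left_derivation u h.
    apply/funext => v; rewrite /left_derivation /= amulBr.
    transitivity ((u ** g v - g (u ** v)) - (u ** h v - h (u ** v))) => //.
    by abelian.
  exact: is_multiplierB.
- have -> : left_derivation u (g \o h) =
      (left_derivation u g \o h) + (g \o left_derivation u h).
    apply/funext => v; transitivity
      (u ** g (h v) - g (u ** h v) + g (u ** h v - h (u ** v))) => //.
    by rewrite /left_derivation /= (multiplier_sub _ _ mg); abelian.
  by apply: is_multiplierD; apply: is_multiplier_comp.
Qed.

Definition multiplier_pred : {pred A -> A} := fun f => `[< is_multiplier f >].

Fact multiplier_zmod_closed : zmod_closed multiplier_pred.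
Proof.
split; first by apply/asboolP; apply: is_multiplier0.
by move=> f g /asboolP mf /asboolP mg; apply/asboolP; apply: is_multiplierB.
Qed.

HB.instance Definition _ :=
  GRing.isZmodClosed.Build (A -> A) multiplier_pred multiplier_zmod_closed.

Variables (x : A) (x_neq0 : x != 0).

(** The nonzero element is recorded in the type so that the ring instance, where 1 must differ from
    0, can be inferred. *)
Definition multiplier of x != 0 : Type := {f | multiplier_pred f}.
Local Notation S := (multiplier x_neq0).

HB.instance Definition _ := SubChoice.copy S {f | multiplier_pred f}.
HB.instance Definition _ := [SubChoice_isSubZmodule of S by <:].

Lemma multiplierP (s : S) : is_multiplier (val s).
Proof. by apply/asboolP; apply: (valP s). Qed.

Definition Multiplier f (mf : is_multiplier f) : S := Sub f (asboolT mf).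

Lemma val_Multiplier f (mf : is_multiplier f) : val (Multiplier mf) = f.
Proof. exact: SubK. Qed.

Let one : S := Multiplier is_multiplier1.
Let mul (s t : S) : S :=
  Multiplier (is_multiplier_comp (multiplierP s) (multiplierP t)).

Lemma multiplier_ext (s t : S) : (forall v, val s v = val t v) -> s = t.
Proof. by move=> e; apply/val_inj/funext. Qed.

Fact multiplier_mulA : associative mul.
Proof. by move=> s t r; apply: multiplier_ext. Qed.

Fact multiplier_mulC : commutative mul.
Proof.
move=> s t; apply: val_inj.
exact: (multiplierC (multiplierP s) (multiplierP t)).
Qed.

Fact multiplier_mul1 : left_id one mul.
Proof. by move=> s; apply: multiplier_ext. Qed.

Fact multiplier_mulDl : left_distributive mul +%R.
Proof. by move=> s t r; apply: multiplier_ext. Qed.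

Fact multiplier_one_neq0 : one != 0.
Proof.
apply: contra x_neq0 => /eqP e; have := congr1 (fun s => val s x) e.
by rewrite /= => ->.
Qed.

HB.instance Definition _ := GRing.Zmodule_isComNzRing.Build S
  multiplier_mulA multiplier_mulC multiplier_mul1
  multiplier_mulDl multiplier_one_neq0.

Lemma val_multiplierM (s t : S) v : val (s * t) v = val s (val t v).
Proof. by []. Qed.

Lemma val_multiplierB (s t : S) v : val (s - t) v = val s v - val t v.
Proof. by []. Qed.

Lemma val_multiplierD (s t : S) v : val (s + t) v = val s v + val t v.
Proof. by []. Qed.

Definition scale_multiplier a : S := Multiplier (is_multiplier_scale a).

Fact scale_multiplier_zmod : zmod_morphism scale_multiplier.
Proof. by move=> a b; apply: multiplier_ext => v; exact: scalerBl. Qed.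

Fact scale_multiplier_monoid : monoid_morphism scale_multiplier.
Proof.
split=> [|a b]; apply: multiplier_ext => v; first exact: scale1r.
by rewrite val_multiplierM /= scalerA.
Qed.

HB.instance Definition _ :=
  GRing.isZmodMorphism.Build F S scale_multiplier scale_multiplier_zmod.
HB.instance Definition _ :=
  GRing.isMonoidMorphism.Build F S scale_multiplier scale_multiplier_monoid.

Definition mulr_multiplier z : S := Multiplier (is_multiplier_mulr z).

Fact mulr_multiplier_zmod : zmod_morphism mulr_multiplier.
Proof. by move=> z w; apply: multiplier_ext => v; exact: amulBr. Qed.

HB.instance Definition _ :=
  GRing.isZmodMorphism.Build A S mulr_multiplier mulr_multiplier_zmod.

Lemma mulr_multiplierZ a z :
  mulr_multiplier (a *: z) = scale_multiplier a * mulr_multiplier z.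
Proof. by apply: multiplier_ext => v; exact: amulZr. Qed.

(** Applied to v: left symmetry is used for v and yz, then for y and v inside (yz)(vw) = (y(vw))z;
    the terms ((yz)v)w and ((yv)w)z cancel. *)
Lemma mulr_multiplierM y z w :
  mulr_multiplier ((y ** z) ** w) =
    mulr_multiplier w * mulr_multiplier (y ** z) +
    mulr_multiplier z * mulr_multiplier (y ** w) -
    mulr_multiplier y * mulr_multiplier z * mulr_multiplier w.
Proof.
apply: multiplier_ext => v.
rewrite val_multiplierB val_multiplierD !val_multiplierM /=.
rewrite (amulA v (y ** z) w) (amulAC y z (v ** w)) (amulA y v w).
rewrite !(amulBl, amulDl) (amulAC y z v) (amulAC v w z) (amulAC (y ** v) w z).
rewrite (amulAC (v ** z) w y) (amulAC v z y) (amulAC (v ** y) w z).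
by abelian.
Qed.

Definition ld_multiplier u (s : S) : S :=
  Multiplier (is_multiplier_left_derivation u (multiplierP s)).

Lemma val_ld_multiplier u (s : S) v :
  val (ld_multiplier u s) v = u ** val s v - val s (u ** v).
Proof. by []. Qed.

Fact ld_multiplier_zmod u : zmod_morphism (ld_multiplier u).
Proof.
move=> s t; apply: multiplier_ext => v.
rewrite val_multiplierB !val_ld_multiplier !val_multiplierB amulBr.
by abelian.
Qed.

HB.instance Definition _ u :=
  GRing.isZmodMorphism.Build S S (ld_multiplier u) (ld_multiplier_zmod u).

Lemma ld_multiplierM u (s t : S) :
  ld_multiplier u (s * t) = ld_multiplier u s * t + s * ld_multiplier u t.
Proof.
apply: multiplier_ext => v.
rewrite val_multiplierD !(val_ld_multiplier, val_multiplierM).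
by rewrite (multiplier_sub _ _ (multiplierP s)); abelian.
Qed.

Lemma ld_mulr_multiplier u z : ld_multiplier u (mulr_multiplier z) =
  mulr_multiplier (u ** z) - mulr_multiplier u * mulr_multiplier z.
Proof.
apply: multiplier_ext => v; rewrite val_multiplierB val_multiplierM /=.
by rewrite left_derivation_mulr.
Qed.

End MultiplicationRing.

(** * An extension field as a Novikov algebra in the class C *)

Section FieldAlgebra.
Variables (F K : fieldType) (iota : {rmorphism F -> K}).

(** Keeping the morphism in the type lets the scalar action be inferred from it. *)
Definition field_algebra of {rmorphism F -> K} : Type := K.
Local Notation B := (field_algebra iota).

HB.instance Definition _ := GRing.Zmodule.copy B K.

Let scale (a : F) (k : B) : B := iota a * (k : K).

Fact field_algebra_scaleA a b (k : B) : scale a (scale b k) = scale (a * b) k.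
Proof. by rewrite /scale rmorphM mulrA. Qed.

Fact field_algebra_scale1 : left_id 1 scale.
Proof. by move=> k; rewrite /scale rmorph1 mul1r. Qed.

Fact field_algebra_scaleDr : right_distributive scale +%R.
Proof. by move=> a k l; apply: mulrDr. Qed.

Fact field_algebra_scaleDl (k : B) : {morph scale^~ k : a b / a + b}.
Proof. by move=> a b; rewrite /scale rmorphD; apply: mulrDl. Qed.

HB.instance Definition _ := GRing.Zmodule_isLmodule.Build F B
  field_algebra_scaleA field_algebra_scale1
  field_algebra_scaleDr field_algebra_scaleDl.

Let mul (k l : B) : B := (k : K) * (l : K).

HB.instance Definition _ := Lmodule_isNonAssocAlgebra.Build F B
  (fun k l m => mulrDl (k : K) l m : mul (k + l) m = mul k m + mul l m)
  (fun k l m => mulrDr (k : K) l m : mul k (l + m) = mul k l + mul k m)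
  (fun a k l => esym (mulrA (iota a) k l) : mul (a *: k) l = a *: mul k l)
  (fun a k l => mulrCA (k : K) (iota a) l : mul k (a *: l) = a *: mul k l).

Fact field_algebra_associatorC (k l m : B) :
  associator k l m = associator l k m.
Proof. by congr (_ - _); [congr (_ * _); apply: mulrC | apply: mulrCA]. Qed.

HB.instance Definition _ := NonAssocAlgebra_isNovikov.Build F B
  field_algebra_associatorC (@mulrAC K).

Lemma field_algebra_ideal (I : set B) :
  is_ideal I -> I <> [set 0] -> I = [set: B].
Proof.
move=> Iid I0; apply/seteqP; split=> // k _.
have [l Il /eqP l0] := ideal0_neq Iid I0.
have := (Iid.2 ((k : K) / l : K) l Il).1.
by rewrite [X in I X](_ : _ = k) //; apply: (@divfK K).
Qed.

Lemma field_algebra_class_C : class_C (B : novikovType F).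
Proof.
have B0 : [set: B] <> [set 0].
  move=> e; have : [set 0] (1 : K) by rewrite -e.
  by move/eqP; rewrite oner_eq0.
have HT : heart (B : novikovType F) = [set: B].
  by apply/seteqP; split=> // k _ I [Iid /(field_algebra_ideal Iid) ->].
split; first by split; rewrite ?HT.
rewrite /idempotent_heart HT; apply/seteqP; split=> // k _.
apply: sub_gen_smallest; exists k, (1 : K); split=> //.
by rewrite [RHS](mulr1 (k : K)).
Qed.

End FieldAlgebra.

(** * A field as homomorphic image when left quasiregularity fails *)

Section Residue.
Variables (F : fieldType) (A : novikovType F).

Lemma not_quasiregular_image : 2%N \notin [pchar F] ->
    lie_solvable A -> ~ left_quasiregular A ->
  exists B : novikovType F, homomorphic_image A B /\ class_C B.
Proof.
move=> char2 [n0 An0] nlqr.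
have [x xP] : exists x : A, forall y, x + y <> y ** x.
  apply: contrapT => no; apply: nlqr => x; apply: contrapT => nox; apply: no.
  by exists x => y e; apply: nox; exists y.
have x_neq0 : x != 0.
  by apply/eqP => x0; apply: (xP 0); rewrite x0 amul0l addr0.
pose S := multiplier x_neq0; pose R := @mulr_multiplier F A x x_neq0.
pose sc := @scale_multiplier F A x x_neq0.
(* Multipliers commute with R_x, so [I] is an ideal; 1 in [I] would give x + y = yx. *)
pose I : set S := [set s | exists y, val s x = y ** x - y].
have [||I1|K [rho [rho_surj rhoI]]] := @exists_residue_field S I.
- by exists 0; rewrite amul0l subr0.
- move=> a u v [y yP] [z zP]; exists (val a y + z).
  rewrite val_multiplierD val_multiplierM yP zP.
  rewrite (multiplier_sub _ _ (multiplierP a)).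
  by rewrite (multiplier_amul _ _ (multiplierP a)) amulDl; abelian.
- case: I1 => y yP; have {}yP : x = y ** x - y := yP.
  by apply: (xP y); rewrite {1}yP subrK.
pose r z := rho (R z).
have rx : r x = 1.
  apply/eqP; rewrite -subr_eq0 -(rmorph1 rho) -rmorphB rhoI //.
  (* R_x - 1 sends x to xx - x, so it lies in [I]. *)
  by exists x; rewrite val_multiplierB.
pose iota : {rmorphism F -> K} := (rho \o sc)%FUN.
have two_neq0 : 2%:R != 0 :> K.
  rewrite -(rmorph_nat iota) fmorph_eq0.
  by apply: contra char2 => e; rewrite !inE.
pose vanish n := forall c, @lie_derived_series F A n c -> r c = 0.
(* Term 0 contains x, with r(x) = 1, while term [n0] is zero; so r starts to vanish at some later
   term. *)
have [n [nv vS]] : exists n, ~ vanish n /\ vanish n.+1.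
  have v0 : ~ vanish 0 by move=> /(_ x Logic.I)/eqP; rewrite rx oner_eq0.
  have : vanish n0 by move=> c; rewrite An0 => ->; rewrite /r /R raddf0 rmorph0.
  elim: n0 {An0} => [//|m IH vm].
  by have [/IH//|nvm] := pselect (vanish m); exists m.
have [x0 [Jx0 rx0]] : exists x0, @lie_derived_series F A n x0 /\ r x0 != 0.
  apply: contrapT => no; apply: nv => c Jc.
  apply/eqP; apply: contrapT => /negP rc.
  by apply: no; exists c.
have rMul z w : r (z ** w) = r z * r w.
  apply: (@residue_mul F A S R (@ld_multiplier F A x x_neq0) _ _ _ K rho
    two_neq0 (@lie_derived_series F A n) _ _ _ x0) => //.
  - exact: ld_multiplierM.
  - exact: ld_mulr_multiplier.
  - exact: mulr_multiplierM.
  - exact: lie_derived_series_ideal.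
  - exact: (@lie_derived_series_ideal F A n.+1).
pose B : novikovType F := field_algebra iota.
have r_linear : linear (r : A -> B).
  by move=> a y z; rewrite /r /R raddfD /= mulr_multiplierZ rmorphD rmorphM.
pose f : {linear A -> B} :=
  HB.pack (r : A -> B) (GRing.isLinear.Build F A B *:%R r r_linear).
exists B; split; last exact: field_algebra_class_C.
exists f; split; first exact: rMul.
apply/seteqP; split=> // k _.
have [s <-] := rho_surj k.
(* Every residue of a multiplier is some r(z), by induction on how the multiplier is built. *)
suff: forall g, is_multiplier g ->
    forall s : S, val s = g -> exists z, rho s = r z.
  by move/(_ _ (multiplierP s) s erefl) => [z ->]; exists z.
move=> {s k} g; elim=> [a|z|g1 g2 m1 IH1 m2 IH2|g1 g2 m1 IH1 m2 IH2] s sE.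
(* As r(x) = 1, the scalar a has the same residue as R_(ax). *)
- exists (a *: x); rewrite -[LHS]mulr1 -rx.
  have -> : s = sc a by apply: val_inj.
  by rewrite /r /R mulr_multiplierZ rmorphM.
- by exists z; congr (rho _); apply: val_inj.
- have [z1 e1] := IH1 (Multiplier x_neq0 m1) erefl.
  have [z2 e2] := IH2 (Multiplier x_neq0 m2) erefl.
  exists (z1 - z2); rewrite /r /R raddfB rmorphB.
  rewrite -[rho (mulr_multiplier _ z1)]e1.
  rewrite -[rho (mulr_multiplier _ z2)]e2 -rmorphB.
  by congr (rho _); apply: val_inj.
- have [z1 e1] := IH1 (Multiplier x_neq0 m1) erefl.
  have [z2 e2] := IH2 (Multiplier x_neq0 m2) erefl.
  exists (z1 ** z2); rewrite rMul -e1 -e2 -rmorphM.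
  by congr (rho _); apply: val_inj.
Qed.

End Residue.

(** * Passage to homomorphic images *)

Section Transfer.
Variables (F : fieldType) (A B : novikovType F) (f : {linear A -> B}).
Hypotheses (fM : forall x y, f (x ** y) = f x ** f y) (fT : range f = [set: B]).

Lemma image_lie_derived_series n :
  @lie_derived_series F B n `<=` f @` @lie_derived_series F A n.
Proof.
elim: n => [|n IH]; first by rewrite fT.
apply: (subset_trans (lie_derivedS IH)); apply: smallest_sub.
  split; first by exists 0; rewrite ?raddf0 //; apply: (lin_span_subspace _).1.
  move=> a _ _ [x Lx <-] [y Ly <-].
  exists (a *: x + y); last by rewrite linearP.
  exact: (lin_span_subspace _).2.
move=> _ [_ [_ [[x Ix <-] [y Iy <-] ->]]]; exists (commutator x y).
  exact: lie_derived_commutator.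
by rewrite /commutator linearB !fM.
Qed.

Lemma image_lie_solvable : lie_solvable A -> lie_solvable B.
Proof.
move=> [n An]; exists n; apply/seteqP.
split=> [x /image_lie_derived_series|_ ->].
  by rewrite An => -[_ -> <-]; rewrite raddf0.
by case: n {An} => // n; apply: (lin_span_subspace _).1.
Qed.

Lemma image_left_quasiregular : left_quasiregular A -> left_quasiregular B.
Proof.
move=> lqr z; have : range f z by rewrite fT.
by move=> [x _ <-]; have [y e] := lqr x; exists (f y); rewrite -fM -e raddfD.
Qed.

End Transfer.

(** * Left quasiregularity, the class A and the radical *)

Lemma left_quasiregular_class_A (F : fieldType) (A : novikovType F) :
  2%N \notin [pchar F] -> lie_solvable A -> left_quasiregular A <-> class_A A.
Proof.
move=> char2 lieA; split=> [lqr [B [[f [fM fT]] BC]]|AA].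
  apply: (quasiregular_not_class_C char2 _ _ BC).
    exact: image_lie_solvable fM fT lieA.
  exact: image_left_quasiregular fM fT lqr.
by apply: contrapT => nlqr; apply/AA/not_quasiregular_image.
Qed.

(** The full ideal, taken as an algebra, is a subtype isomorphic to [A]; homomorphisms are
    transported along the inclusion and its inverse. *)
Lemma class_A_ideal_setT (F : fieldType) (A : novikovType F) :
  class_A_ideal [set: A] <-> class_A A.
Proof.
split=> [[idT AT] [B [[f [fM fT]] BC]]|AA].
  apply: AT; exists B; split=> //.
  pose g (z : ideal_alg idT) : B := f (val z).
  have g_linear : linear g by move=> a y z; rewrite /g -linearP.
  pose g' : {linear ideal_alg idT -> B} :=
    HB.pack g (GRing.isLinear.Build F _ _ *:%R g g_linear).
  exists g'; split=> [y z|]; first exact: fM.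
  apply/seteqP; split=> // b _; have : range f b by rewrite fT.
  by move=> [y _ <-]; exists (Sub y (mem_set (Logic.I : [set: A] y))).
exists (ideal_setT A) => -[B [[f [fM fT]] BC]]; apply: AA; exists B; split=> //.
pose inj (y : A) : ideal_alg (ideal_setT A) :=
  Sub y (mem_set (Logic.I : [set: A] y)).
have g_linear : linear (f \o inj).
  by move=> a y z; rewrite -linearP; congr (f _); apply: val_inj.
pose g : {linear A -> B} :=
  HB.pack (f \o inj) (GRing.isLinear.Build F _ _ *:%R (f \o inj) g_linear).
exists g; split=> [y z|].
  by rewrite -fM; congr (f _); apply: val_inj.
apply/seteqP; split=> // b _; have : range f b by rewrite fT.
by move=> [y _ <-]; exists (val y) => //; congr (f _); apply: val_inj.
Qed.

Lemma andrunakievich_radical_setT (F : fieldType) (A : novikovType F) :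
  andrunakievich_radical A = [set: A] <-> class_A A.
Proof.
rewrite -class_A_ideal_setT /andrunakievich_radical; split=> [|AT].
  (* In the default case the radical would be [set0], which misses 0. *)
  case: xgetP => [I _ [II _] <- //|_ e].
  by have : [set: A] 0 by []; rewrite -e.
(* Here the full set is itself a largest ideal of the class, which rules out the default and forces
   the chosen ideal to contain it. *)
by case: xgetP => [I _ [_ /(_ _ AT)]|/(_ [set: A])]; [rewrite subTset|case].
Qed.

Theorem theorem3p6 (F : fieldType) (char_neq2 : 2%N \notin [pchar F])
    (A : novikovType F) (lieA : lie_solvable A) :
  left_quasiregular A <-> andrunakievich_radical A = [set: A].
Proof.
by rewrite andrunakievich_radical_setT; apply: left_quasiregular_class_A.
Qed.
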